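(* Let $\mathcal{F}:\mathbb{F}_{q^t}^r\to\mathbb{F}_q^{rt}$ be a vfr-map, $\mathcal{D}$ the Desarguesian spread obtained from $\mathcal{F}$, and let $\pi$ be an $(n-1)$-dimensional subspace of $\mathrm{PG}(rt-1,q)$ with $L=\mathcal{B}(\pi)$. Then Condition (A) holds for $(L,n)$ if and only if the number of $(n-1)$-dimensional subspaces $\pi'$ of $\mathrm{PG}(rt-1,q)$ with $\mathcal{B}(\pi')=L$ equals $$\frac{|\mathrm{P}\Gamma\mathrm{L}(r,q^t)_{\mathcal{B}(\pi)}|}{|\mathrm{P}\Gamma\mathrm{L}(rt,q)_{\mathcal{D},\pi}|}\cdot\frac{q^t-1}{q-1}.$$
   Context: A vector field reduction map (vfr-map) $\mathcal{F}:\mathbb{F}_{q^t}^r\to\mathbb{F}_q^{rt}$ is an $\mathbb{F}_q$-linear bijection (e.g. obtained by fixing an $\mathbb{F}_q$-basis of $\mathbb{F}_{q^t}$ and writing each coordinate in that basis). $\mathrm{PG}(rt-1,q)$ is the projective space of $\mathbb{F}_q^{rt}$ and $\mathrm{PG}(r-1,q^t)$ that of $\mathbb{F}_{q^t}^r$; $\langle v\rangle_q$, $\langle v\rangle_{q^t}$ denote the corresponding projective points, and for a subspace $U$ of $\mathbb{F}_q^{rt}$, $\langle U\rangle_q$ is the projective subspace it determines. The Desarguesian spread obtained from $\mathcal{F}$ is $\mathcal{D}=\{\{\langle\mathcal{F}(\alpha v)\rangle_q\mid\alpha\in\mathbb{F}_{q^t}^*\}\mid v\in\mathbb{F}_{q^t}^r\setminus\{0\}\}$,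 a $(t-1)$-spread of $\mathrm{PG}(rt-1,q)$; its element $\{\langle\mathcal{F}(\alpha v)\rangle_q\}$ corresponds to the point $\langle v\rangle_{q^t}$ of $\mathrm{PG}(r-1,q^t)$. For an $\mathbb{F}_q$-subspace $U$ of $\mathbb{F}_q^{rt}$ put $\mathcal{B}(U)=\{\langle v\rangle_{q^t}\mid v\in\mathcal{F}^{-1}(U\setminus\{0\})\}$ (an $\mathbb{F}_q$-linear set of $\mathrm{PG}(r-1,q^t)$), and for $\pi=\langle U\rangle_q$ put $\mathcal{B}(\pi)=\mathcal{B}(U)$. Condition (A) for $(L,n)$: for any two $(n-1)$-dimensional subspaces $\pi,\pi'$ of $\mathrm{PG}(rt-1,q)$ with $\mathcal{B}(\pi)=L=\mathcal{B}(\pi')$, there exists $\gamma\in\mathrm{P}\Gamma\mathrm{L}(rt,q)$ with (a) $\gamma(\pi)=\pi'$, (b) $\gamma$ preserves $\mathcal{D}$, (c) the induced map of $\gamma$ on $\mathrm{PG}(r-1,q^t)$ (via the correspondence between elements of $\mathcal{D}$ and points) is a collineation. $\mathrm{P}\Gamma\mathrm{L}(r,q^t)_{\mathcal{B}(\pi)}$ is the setwise stabiliser of the point set $\mathcal{B}(\pi)$ in $\mathrm{P}\Gamma\mathrm{L}(r,q^t)$, and $\mathrm{P}\Gamma\mathrm{L}(rt,q)_{\mathcal{D},\pi}$ is the subgroup of $\mathrm{P}\Gamma\mathrm{L}(rt,q)$ stabilising both $\mathcal{D}$ and $\pi$.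
   Formalization: The theorem is stated for r ≥ 2; for r = 1 it is false: with r = n = 1, t = 2, q = 3 Condition (A) holds and there are 4 subspaces π', but the right-hand side is 2/3 or 4/3. *)

(* Defs.v *)
From HB Require Import structures.
From mathcomp Require Import all_boot all_order all_fingroup all_algebra.
From mathcomp Require Import boolp.

Set Implicit Arguments.
Unset Strict Implicit.
Unset Printing Implicit Defensive.

Import GRing.Theory.
Local Open Scope ring_scope.

(* The library only provides a choiceType structure on {vspace vT}. *)
Section VspaceFinite.
Variables (K : finFieldType) (vT : vectType K).
Import VectorInternalTheory.
HB.instance Definition _ : isCountable {vspace vT} :=
  CanIsCountable (@vs2mxK K vT).
HB.instance Definition _ : isFinite {vspace vT} :=
  CanIsFinite (@vs2mxK K vT).
End VspaceFinite.

(* PG(m-1, K) is taken as the set of its points; a projective subspace is the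
   set of points lying on it. *)
Notation point K m := {P : {vspace 'rV[K]_m} | \dim P == 1%N}.

Definition psub (K : finFieldType) (m : nat) (U : {vspace 'rV[K]_m}) :
  {set point K m} := [set P : point K m | (val P <= U)%VS].

Definition semilinear (K : finFieldType) (m : nat)
    (f : 'rV[K]_m -> 'rV[K]_m) : Prop :=
  {morph f : u v / u + v} /\
  exists2 s : {rmorphism K -> K}, bijective s &
    forall a v, f (a *: v) = s a *: f v.

(* PGammaL(m, K), as the group of the permutations of the points that are
   induced by an invertible semilinear map. *)
Definition PGammaL (K : finFieldType) (m : nat) : {set {perm point K m}} :=
  [set g : {perm point K m} |
    `[< exists f : 'rV[K]_m -> 'rV[K]_m,
          [/\ semilinear f, bijective f
            & forall P v, (f v \in val (g P)) = (v \in val P)] >]].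

Section Reduction.

(* F and K stand for F_q and F_{q^t}, and iota embeds F in K. *)
Variables (F K : finFieldType) (iota : {rmorphism F -> K}) (r t : nat).
Variable FF : 'rV[K]_r -> 'rV[F]_(r * t).

Definition vfr_map : Prop :=
  [/\ bijective FF, {morph FF : u v / u + v}
    & forall (a : F) v, FF (iota a *: v) = a *: FF v].

Definition spread_elt (v : 'rV[K]_r) : {set point F (r * t)} :=
  [set Q : point F (r * t) |
    [exists a : K, (a != 0) && (val Q == <[FF (a *: v)]>%VS)]].

Definition spread : {set {set point F (r * t)}} :=
  [set spread_elt v | v in [pred v : 'rV[K]_r | v != 0]].

Definition linset (U : {vspace 'rV[F]_(r * t)}) : {set point K r} :=
  [set P : point K r |
    [exists v : 'rV[K]_r,
      [&& FF v \in U, FF v != 0 & val P == <[v]>%VS]]].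

(* g maps the spread element of each point P to the spread element of d P. *)
Definition induces (g : {perm point F (r * t)}) (d : {perm point K r}) : Prop :=
  forall (P : point K r) v w, val P = <[v]>%VS -> val (d P) = <[w]>%VS ->
    g @: spread_elt v = spread_elt w.

(* Collineations of PG(r-1, q^t) are the elements of PGammaL(r, q^t); for
   r = 2 preserving incidence would be no restriction. *)
Definition condition_A (L : {set point K r}) (n : nat) : Prop :=
  forall U U' : {vspace 'rV[F]_(r * t)},
    \dim U = n -> \dim U' = n -> linset U = L -> linset U' = L ->
    exists2 g, g \in PGammaL F (r * t) &
      [/\ g @: psub U = psub U',
          [set g @: (S : {set point F (r * t)}) | S in spread] = spread
        & exists2 d, d \in PGammaL K r & induces g d].

(* Subspaces <U'>_q of vector dimension n with B(<U'>_q) = L. *)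
Definition subspaces_with_linset (L : {set point K r}) (n : nat) :
    {set {set point F (r * t)}} :=
  [set psub U' | U' in [pred U' : {vspace 'rV[F]_(r * t)} |
                         (\dim U' == n) && (linset U' == L)]].

End Reduction.

(* Main.v *)
(* Write W for the F-space of all vectors, seen as K^r through FF. If an
   F-semilinear bijection f permutes the spread, that is, the K-lines, then for
   each a in K the vector f (a v) is a multiple of f v, by a factor that does
   not depend on v because r >= 2; so f is K-semilinear. Conversely a
   K-semilinear map is F-semilinear, F being the only subfield of its order.
   Thus the stabiliser of the spread in PGammaL(rt, q) and PGammaL(r, q^t) are
   both quotients of GammaL(r, q^t), by F^* and K^* respectively, and condition
   (A) says that the stabiliser of L in GammaL(r, q^t) is transitive on the
   subspaces with linear set L. Since the stabiliser of pi also stabilises L,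
   the claim is the orbit-stabiliser theorem. *)
Require Import Defs.
From HB Require Import structures.
From mathcomp Require Import all_boot all_order all_fingroup all_algebra.
From mathcomp Require Import boolp finfield.
Set Implicit Arguments.
Unset Strict Implicit.
Unset Printing Implicit Defensive.
Import GRing.Theory.
Local Open Scope ring_scope.

(** * Lines spanned by vectors, proportional maps, semilinear maps *)

Lemma additive0 (V W : zmodType) (h : V -> W) :
  {morph h : u v / u + v} -> h 0 = 0.
Proof. by move=> hD; apply: (addIr (h 0)); rewrite -hD !add0r. Qed.

Lemma vline_eq (K : fieldType) (vT : vectType K) (u v : vT) :
  v != 0 -> v \in <[u]>%VS -> <[u]>%VS = <[v]>%VS.
Proof.
move=> v_neq0 vu; apply/eqP; rewrite eq_sym eqEdim -memvE vu !dim_vline v_neq0.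
by case: (u != 0).
Qed.

Lemma exists_notin_line (K : fieldType) (m : nat) (v : 'rV[K]_m) :
  (1 < m)%N -> exists w, w \notin <[v]>%VS.
Proof.
move=> m_gt1; apply: contrapT => /forallNP vfull.
have /dimvS : (fullv <= <[v]>)%VS by apply/subvP => w _; apply/negPn/negP/vfull.
rewrite dimvf /dim /= mul1n dim_vline leqNgt.
by rewrite (leq_ltn_trans (leq_b1 _) m_gt1).
Qed.

(* If [h2 u = a h1 u], [h2 v = b h1 v] and [h2 (u + v) = c h1 (u + v)], then
   [(c - a) h1 u = (b - c) h1 v], so [a = b] when [u] and [v] are
   independent. *)
Lemma proportional_additive (K : fieldType) (m n : nat)
    (h1 h2 : 'rV[K]_m -> 'rV[K]_n) :
  (1 < m)%N -> {morph h1 : u v / u + v} -> {morph h2 : u v / u + v} ->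
  injective h1 ->
  (forall u v, u != 0 -> h1 v \in <[h1 u]>%VS -> v \in <[u]>%VS) ->
  (forall v, h2 v \in <[h1 v]>%VS) ->
  exists b, forall v, h2 v = b *: h1 v.
Proof.
move=> m_gt1 h1D h2D h1inj h1line h2h1.
have /choice [b bP] : forall v, exists b, h2 v = b *: h1 v.
  by move=> v; apply/vlineP.
have b_indep u v : u != 0 -> v \notin <[u]>%VS -> b u = b v.
  move=> u_neq0 vu; set c := b (u + v).
  have h1u_neq0 : h1 u != 0 by rewrite -(additive0 h1D) (inj_eq h1inj).
  have eq1 : (c - b u) *: h1 u = (b v - c) *: h1 v.
    apply/eqP; rewrite !scalerBl subr_eq addrAC -!bP -subr_eq opprK addrC.
    by rewrite -scalerDr -h1D -bP h2D addrC.
  have [bvc | bvc] := eqVneq (b v) c.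
    move/eqP: eq1; rewrite bvc subrr scale0r scaler_eq0 (negPf h1u_neq0) orbF.
    by rewrite subr_eq0 => /eqP.
  case/negP: vu; apply: h1line => //; apply/vlineP.
  exists ((b v - c)^-1 * (c - b u)).
  by rewrite -scalerA eq1 scalerA mulVf ?scale1r // subr_eq0.
(* The line of [0] is the zero space, so a vector off it is a nonzero vector. *)
have [e e_neq0] := exists_notin_line (0 : 'rV[K]_m) m_gt1.
have {}e_neq0 : e != 0 by apply: contra e_neq0 => /eqP->; apply: mem0v.
have [w we] := exists_notin_line e m_gt1.
exists (b e) => v; have [-> | v_neq0] := eqVneq v 0.
  by rewrite (additive0 h1D) (additive0 h2D) scaler0.
(* If [v] lies on the line of [e], the two are compared through [w], which is off that common
   line. *)
have [ve | ve] := boolP (v \in <[e]>%VS); last by rewrite (b_indep e v).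
by rewrite (b_indep e w) // -(b_indep v w) // -(vline_eq v_neq0 ve).
Qed.

(* Unqualified, [semilinear] would now be [GRing.semilinear]. *)
Lemma semilinearI (K : finFieldType) (m : nat) (f : 'rV[K]_m -> 'rV[K]_m) :
  (0 < m)%N -> injective f -> {morph f : u v / u + v} ->
  (forall a, exists b, forall v, f (a *: v) = b *: f v) -> Defs.semilinear f.
Proof.
move=> m_gt0 f_inj fD /choice[s sP]; split; first exact: fD.
(* Any nonzero vector would do: the factors [s a] are read off at [f e], and the laws of a ring
   morphism follow by cancelling [f e]. *)
pose e : 'rV[K]_m := const_mx 1.
have e_neq0 : e != 0.
  by apply/eqP => /rowP/(_ (Ordinal m_gt0))/eqP; rewrite !mxE oner_eq0.
have fe_neq0 : f e != 0 by rewrite -(additive0 fD) (inj_eq f_inj).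
have fe_inj a b : a *: f e = b *: f e -> a = b.
  move/eqP; rewrite -subr_eq0 -scalerBl scaler_eq0 (negPf fe_neq0) orbF.
  by rewrite subr_eq0 => /eqP.
have s_nmod : nmod_morphism s.
  split => [|a b]; apply: fe_inj.
    by rewrite -sP !scale0r (additive0 fD).
  by rewrite -sP !scalerDl fD !sP.
have s_monoid : monoid_morphism s.
  split => [|a b]; apply: fe_inj; first by rewrite -sP !scale1r.
  by rewrite -sP -!scalerA !sP.
pose s' : {rmorphism K -> K} :=
  HB.pack s (GRing.isNmodMorphism.Build _ _ s s_nmod)
            (GRing.isMonoidMorphism.Build _ _ s s_monoid).
(* A field endomorphism is injective, hence bijective since [K] is finite. *)
exists s' => //; exact: injF_bij (fmorph_inj s').
Qed.

(** * The group GammaL(m, K) and its action on points *)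

Section Semilinear.
Variables (K : finFieldType) (m : nat).
Implicit Types (f g : {perm 'rV[K]_m}) (d : {perm point K m}).
Implicit Types (P : point K m) (A : {set point K m}).

Definition GammaL : {set {perm 'rV[K]_m}} :=
  [set f : {perm 'rV[K]_m} | `[< Defs.semilinear f >]].

Lemma GammaLP f : reflect (Defs.semilinear f) (f \in GammaL).
Proof. by rewrite inE; apply: asboolP. Qed.

(** In a finite group, closure under products already gives inverses. *)
Lemma GammaL_group_set : (0 < m)%N -> group_set GammaL.
Proof.
move=> m_gt0; apply/group_setP; split.
  apply/GammaLP/semilinearI => //; first exact: perm_inj.
    by move=> u v; rewrite !perm1.
  by move=> a; exists a => v; rewrite !perm1.
move=> f g /GammaLP[fD [s _ fZ]] /GammaLP[gD [s' _ gZ]].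
apply/GammaLP/semilinearI => //; first exact: perm_inj.
  by move=> u v; rewrite !permM fD gD.
by move=> a; exists (s' (s a)) => v; rewrite !permM fZ gZ.
Qed.

Lemma GammaLV f : (0 < m)%N -> f \in GammaL -> (f^-1)%g \in GammaL.
Proof. by move=> m_gt0; rewrite (groupV (Group (GammaL_group_set m_gt0))). Qed.

Lemma mem_line_semilinear f u v : f \in GammaL ->
  (f v \in <[f u]>%VS) = (v \in <[u]>%VS).
Proof.
case/GammaLP=> fD [s [s' sK s'K] fZ]; apply/vlineP/vlineP => -[a].
  by rewrite -[a]s'K -fZ => /perm_inj ->; exists (s' a).
by move->; rewrite fZ; exists (s a).
Qed.

Lemma semilinear0 f : f \in GammaL -> f 0 = 0.
Proof. by case/GammaLP=> /additive0. Qed.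

Lemma pointP P : exists2 v, v != 0 & val P = <[v]>%VS.
Proof.
have /eqP dimP := valP P; exists (vpick (val P)).
  by rewrite vpick0 -dimv_eq0 dimP.
apply/esym/eqP; rewrite eqEdim -memvE memv_pick dim_vline vpick0 -dimv_eq0 dimP.
by [].
Qed.

Definition line_point (v : 'rV[K]_m) (v_neq0 : v != 0) : point K m :=
  exist (fun L : {vspace 'rV[K]_m} => \dim L == 1%N) <[v]>%VS
        (introT eqP (etrans (dim_vline v) (congr1 nat_of_bool v_neq0))).

Definition induced_on_points f d :=
  [forall P, forall v, (f v \in val (d P)) == (v \in val P)].

Lemma induced_on_pointsP f d :
  reflect (forall P v, (f v \in val (d P)) = (v \in val P))
    (induced_on_points f d).
Proof.
apply: (iffP forallP) => fd P.
  by move=> v; apply/eqP; move: v; apply/forallP/fd.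
by apply/forallP => v; rewrite fd.
Qed.

Lemma induced_on_points_inj f d d' :
  induced_on_points f d -> induced_on_points f d' -> d = d'.
Proof.
move=> /induced_on_pointsP fd /induced_on_pointsP fd'.
apply/permP => P; apply/val_inj/vspaceP => v.
by rewrite -[v](permKV f) fd fd'.
Qed.

Lemma induced_on_points_exists f : f \in GammaL ->
  exists d, induced_on_points f d.
Proof.
move=> fG.
have /choice[d dP] : forall P, exists Q : point K m,
    forall v, (f v \in val Q) = (v \in val P).
  move=> P; have [u u_neq0 ->] := pointP P.
  have fu_neq0 : f u != 0 by rewrite -(semilinear0 fG) (inj_eq perm_inj).
  exists (line_point fu_neq0) => v /=.
  exact: mem_line_semilinear.
have d_inj : injective d.
  by move=> P Q dPQ; apply/val_inj/vspaceP => v; rewrite -(dP P) -(dP Q) dPQ.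
by exists (perm d_inj); apply/induced_on_pointsP => P v; rewrite permE.
Qed.

(** The value [1] is a default for permutations of vectors that induce none on points; every element
    of [GammaL] induces exactly one. *)
Definition point_perm f : {perm point K m} :=
  odflt 1%g [pick d | induced_on_points f d].

Lemma mem_point_perm f : f \in GammaL ->
  forall P v, (f v \in val (point_perm f P)) = (v \in val P).
Proof.
move=> fG; apply/induced_on_pointsP; rewrite /point_perm.
case: pickP => //= no_d.
by have [d] := induced_on_points_exists fG; rewrite no_d.
Qed.

Lemma point_perm_eq f d : f \in GammaL ->
  (forall P v, (f v \in val (d P)) = (v \in val P)) -> point_perm f = d.
Proof.
move=> /mem_point_perm/induced_on_pointsP fp /induced_on_pointsP.
exact: induced_on_points_inj.
Qed.

Lemma point_perm_line f P v : f \in GammaL -> v != 0 -> val P = <[v]>%VS ->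
  val (point_perm f P) = <[f v]>%VS.
Proof.
move=> fG v_neq0 Pv; have [w _ fPw] := pointP (point_perm f P).
rewrite fPw; apply: vline_eq.
  by rewrite -(semilinear0 fG) (inj_eq perm_inj).
by rewrite -fPw mem_point_perm // Pv memv_line.
Qed.

Lemma PGammaLE : PGammaL K m = point_perm @: GammaL.
Proof.
apply/setP => d; rewrite inE; apply/asboolP/imsetP.
  move=> [f [f_sl f_bij fd]]; pose f' := perm (bij_inj f_bij).
  have f'E : f' =1 f by move=> v; rewrite permE.
  have f'G : f' \in GammaL by apply/GammaLP; rewrite (funext f'E).
  by exists f' => //; apply/esym/point_perm_eq => // P v; rewrite f'E.
move=> [f fG ->]; exists f; split; first exact/GammaLP.
  exact: injF_bij perm_inj.
exact: mem_point_perm.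
Qed.

(** * Scalars as the kernel of GammaL -> PGammaL *)

Lemma unit_neq0 (a : {unit K}) : FinRing.uval a != 0.
Proof. by rewrite -unitfE; case: a. Qed.

Lemma scaler_unit_inj (a : {unit K}) :
  injective (fun v : 'rV[K]_m => FinRing.uval a *: v).
Proof. by apply: (can_inj (scalerK _)); apply: unit_neq0. Qed.

(** Maps with the same action on points have proportional values at each vector;
    [proportional_additive] makes the factor constant, and it is nonzero by injectivity. *)
Lemma point_perm_fiber f : (1 < m)%N -> f \in GammaL ->
  [set g in GammaL | point_perm g == point_perm f]
    = [set (f * perm (@scaler_unit_inj a))%g | a : {unit K}].
Proof.
move=> m_gt1 fG; apply/setP => g; rewrite inE; apply/andP/imsetP.
  move=> [gG /eqP gf].
  have [|||u v u_neq0|v|b gbf] := @proportional_additive K m m f g m_gt1.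
  - by have /GammaLP[] := fG.
  - by have /GammaLP[] := gG.
  - exact: perm_inj.
  - by rewrite mem_line_semilinear.
  - have [-> | v_neq0] := eqVneq v 0; first by rewrite (semilinear0 gG) mem0v.
    have Pv : val (line_point v_neq0) = <[v]>%VS by [].
    by rewrite -(point_perm_line fG v_neq0 Pv) -gf mem_point_perm // memv_line.
  have b_neq0 : b != 0.
    have [w w0] := exists_notin_line (0 : 'rV[K]_m) m_gt1.
    apply: contra w0 => /eqP b0; suff -> : w = 0 by apply: mem0v.
    by apply: (@perm_inj _ g); rewrite gbf b0 scale0r (semilinear0 gG).
  have b_unit : b \is a GRing.unit by rewrite unitfE.
  exists (FinRing.Unit b_unit) => //.
  by apply/permP => v; rewrite permM permE gbf.
move=> [a _ ->].
have gE v : (f * perm (@scaler_unit_inj a))%g v = FinRing.uval a *: f v.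
  by rewrite permM permE.
have gG : (f * perm (@scaler_unit_inj a))%g \in GammaL.
  have /GammaLP[fD [s _ fZ]] := fG.
  apply/GammaLP/semilinearI => //; [exact: ltnW | exact: perm_inj | | ].
    by move=> u v; rewrite !gE fD scalerDr.
  by move=> b; exists (s b) => v; rewrite !gE fZ !scalerA mulrC.
split=> //; apply/eqP/point_perm_eq => // P v.
by rewrite gE rpredZeq (negPf (unit_neq0 a)) mem_point_perm.
Qed.

Lemma card_point_perm_fiber f : (1 < m)%N -> f \in GammaL ->
  #|[set g in GammaL | point_perm g == point_perm f]| = #|K|.-1.
Proof.
move=> m_gt1 fG; rewrite point_perm_fiber //.
rewrite card_imset => [|a b /(mulgI f)/permP ab].
  by rewrite -card_finField_unit cardsT.
have [e e0] := exists_notin_line (0 : 'rV[K]_m) m_gt1.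
have e_neq0 : e != 0 by apply: contra e0 => /eqP->; apply: mem0v.
apply/val_inj/eqP; move/eqP: (ab e); rewrite !permE -subr_eq0 -scalerBl.
by rewrite scaler_eq0 (negPf e_neq0) orbF subr_eq0.
Qed.

(** All fibres of [point_perm] over [PGammaL] have the size of the group of scalars. With [B] a
    stabiliser, this moves the count from the projective group to [GammaL]. *)
Lemma card_GammaL_lift (B : {set {perm point K m}}) : (1 < m)%N ->
  (#|PGammaL K m :&: B| * #|K|.-1)%N =
    #|[set f in GammaL | point_perm f \in B]|.
Proof.
move=> m_gt1; rewrite PGammaLE.
rewrite -sum_nat_const -[RHS]sum1_card.
pose D := point_perm @: GammaL :&: B.
rewrite (partition_big point_perm (mem D)) /=; last first.
  by move=> f; rewrite inE => /andP[fG fB]; rewrite inE imset_f.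
apply: eq_bigr => d /setIP[/imsetP[f fG ->] fB].
rewrite -(card_point_perm_fiber m_gt1 fG) -sum1_card; apply: eq_bigl => g.
by rewrite !inE; case: eqP => [->|_]; rewrite ?fB ?imset_f ?andbT ?andbF.
Qed.

(** * Point sets as sets of vectors, and images of subspaces *)

(** Turns stabilisers of point sets into stabilisers of vector sets. The vector 0, which lies in
    every point, is left out so that a nonzero vector determines its point. *)
Definition cone A : {set 'rV[K]_m} :=
  [set v | (v != 0) && [exists P in A, v \in val P]].

Lemma mem_coneP A v :
  reflect (v != 0 /\ exists2 P, P \in A & v \in val P) (v \in cone A).
Proof. by rewrite inE; apply: (iffP andP) => -[-> /exists_inP]. Qed.

Lemma mem_cone_line P A v : v != 0 -> val P = <[v]>%VS ->
  (v \in cone A) = (P \in A).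
Proof.
move=> v_neq0 Pv; apply/mem_coneP/idP => [[_ [Q QA vQ]] | PA].
  have [w _ Qw] := pointP Q; rewrite Qw in vQ.
  by suff -> : P = Q by []; apply: val_inj; rewrite Pv Qw (vline_eq v_neq0 vQ).
by split=> //; exists P; rewrite // Pv memv_line.
Qed.

Lemma cone_inj : injective cone.
Proof.
move=> A B AB; apply/setP => P; have [v v_neq0 Pv] := pointP P.
by rewrite -!(mem_cone_line _ v_neq0 Pv) AB.
Qed.

Lemma cone_point_perm f A : f \in GammaL ->
  cone (point_perm f @: A) = f @: cone A.
Proof.
move=> fG; apply/setP => w; rewrite -[w](permKV f) (mem_imset _ _ perm_inj).
set v := (f^-1)%g w.
have fv_neq0 : (f v != 0) = (v != 0).
  by rewrite -{1}(semilinear0 fG) (inj_eq perm_inj).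
apply/mem_coneP/mem_coneP; rewrite fv_neq0 => -[v_neq0].
  case=> _ /imsetP[P PA ->]; rewrite mem_point_perm // => vP.
  by split=> //; exists P.
case=> P PA vP; split=> //.
by exists (point_perm f P); rewrite ?imset_f ?mem_point_perm.
Qed.

Lemma cone_psub (U : {vspace 'rV[K]_m}) v :
  (v \in cone (psub U)) = (v != 0) && (v \in U).
Proof.
have [-> | v_neq0] /= := eqVneq v 0; first by rewrite inE eqxx.
rewrite (@mem_cone_line (line_point v_neq0)) // inE /=.
by rewrite -memvE.
Qed.

Lemma semilinear_span f (X : seq 'rV[K]_m) (W : {vspace 'rV[K]_m}) :
  f \in GammaL -> {in X, forall u, f u \in W} ->
  forall v, v \in <<X>>%VS -> f v \in W.
Proof.
move=> fG XW v /(@coord_span _ _ _ (in_tuple X)) ->.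
have /GammaLP[fD [s _ fZ]] := fG.
apply: (big_ind (fun v => f v \in W)) => [|u w fu fw|i _].
- by rewrite (semilinear0 fG) mem0v.
- by rewrite fD memvD.
by rewrite fZ memvZ // XW // mem_nth.
Qed.

(** The images of a basis of [U] span the image, which bounds its dimension by that of [U]; the same
    bound for the inverse of [f] gives equality. *)
Lemma semilinear_image f (U : {vspace 'rV[K]_m}) : (0 < m)%N -> f \in GammaL ->
  exists2 W : {vspace 'rV[K]_m},
    \dim W = \dim U & forall v, (f v \in W) = (v \in U).
Proof.
move=> m_gt0; have imle g (V : {vspace 'rV[K]_m}) : g \in GammaL ->
    exists2 W : {vspace 'rV[K]_m},
      (\dim W <= \dim V)%N & forall v, (g v \in W) = (v \in V).
  move=> gG; exists <<map g (vbasis V)>>%VS.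
    by apply: leq_trans (dim_span _) _; rewrite size_map size_tuple.
  move=> v; apply/idP/idP => [gvW | vV].
    rewrite -[v](permK g); apply: semilinear_span gvW; first exact: GammaLV.
    by move=> _ /mapP[u uV ->]; rewrite permK (vbasis_mem uV).
  have := vV; rewrite -{1}(span_basis (vbasisP V)).
  apply: semilinear_span => //.
  by move=> u uV; rewrite memv_span // map_f.
move=> fG; have [W WU fW] := imle f U fG; exists W => //.
have [U' U'W fU'] := imle _ W (GammaLV m_gt0 fG).
apply/eqP; rewrite eqn_leq WU /=; suff <- : U' = U by [].
by apply/vspaceP => v; rewrite -[v in v \in U'](permK f) fU' fW.
Qed.

End Semilinear.

(** * The subfield of order q, and stabilisers of sets *)

(** [X ^ #|F| - X] is the product of the [X - b] for [b] in [F]. Mapped to [K], it has [s (iota a)]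
    as a root, which must then be some [iota b]. *)
Lemma rmorph_finField_range (F K : finFieldType) (iota : {rmorphism F -> K})
    (s : {rmorphism K -> K}) (a : F) : exists b, s (iota a) = iota b.
Proof.
have /(congr1 (fun p => (map_poly iota p).[s (iota a)])) := finField_genPoly F.
rewrite rmorphB /= map_polyXn map_polyX !hornerE -!rmorphXn /= expf_card subrr.
rewrite rmorph_prod horner_prod => /esym/eqP/prodf_eq0[b _].
by rewrite rmorphB /= map_polyX map_polyC !hornerE subr_eq0 => /eqP; exists b.
Qed.

Lemma mem_astabs_perm (T : finType) (g : {perm T}) (A : {set T}) :
  (g \in 'N(A | 'P)%g) = (g @: A == A).
Proof. by rewrite -astab1_set; apply/astab1P/eqP. Qed.

Lemma mem_astabs_set_perm (T : finType) (g : {perm T}) (S : {set {set T}}) :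
  (g \in 'N(S | 'P^* )%g) = ([set g @: (A : {set T}) | A in S] == S).
Proof. by rewrite -astab1_set; apply/astab1P/eqP. Qed.

Lemma point_perm_astabs (K : finFieldType) (m : nat) (f : {perm 'rV[K]_m})
    (A : {set point K m}) : f \in GammaL K m ->
  (point_perm f \in 'N(A | 'P)%g) = (f \in 'N(cone A | 'P)%g).
Proof.
move=> fG; rewrite !mem_astabs_perm -cone_point_perm //.
by rewrite (inj_eq (@cone_inj _ _)).
Qed.

(** * Field reduction: maps and point sets carried along [FF] *)

Section Reduction.
Variables (F K : finFieldType) (iota : {rmorphism F -> K}) (r t : nat).
Variables (FF : 'rV[K]_r -> 'rV[F]_(r * t)) (FI : 'rV[F]_(r * t) -> 'rV[K]_r).
Hypotheses (FFK : cancel FF FI) (FIK : cancel FI FF).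
Hypothesis FFD : {morph FF : u v / u + v}.
Hypothesis FFZ : forall (a : F) v, FF (iota a *: v) = a *: FF v.
Hypotheses (r_gt1 : (1 < r)%N) (t_gt0 : (0 < t)%N).
Implicit Types (f : {perm 'rV[K]_r}) (A : {set point F (r * t)}).
Implicit Types (U W : {vspace 'rV[F]_(r * t)}).

Let r_gt0 : (0 < r)%N. Proof. exact: ltnW. Qed.
Let rt_gt1 : (1 < r * t)%N.
Proof. by apply: leq_trans r_gt1 _; rewrite leq_pmulr. Qed.
Let rt_gt0 : (0 < r * t)%N. Proof. exact: ltnW. Qed.
Let FF_inj : injective FF. Proof. exact: can_inj FFK. Qed.
Let FF0 : FF 0 = 0. Proof. exact: additive0. Qed.

Lemma conjFF_subproof f : injective (FF \o f \o FI).
Proof. by apply: inj_comp (can_inj FIK); apply: inj_comp FF_inj perm_inj. Qed.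

Definition conjFF f : {perm 'rV[F]_(r * t)} := perm (@conjFF_subproof f).

Lemma conjFFE f v : conjFF f (FF v) = FF (f v).
Proof. by rewrite permE /= FFK. Qed.

Lemma conjFF_inj : injective conjFF.
Proof.
by move=> f g /permP fg; apply/permP => v; apply: FF_inj; rewrite -!conjFFE fg.
Qed.

Lemma conjFF_surj (g : {perm 'rV[F]_(r * t)}) : exists f, g = conjFF f.
Proof.
have h_inj : injective (FI \o g \o FF).
  by apply: inj_comp FF_inj; apply: inj_comp (can_inj FIK) perm_inj.
by exists (perm h_inj); apply/permP => w; rewrite -[w]FIK conjFFE permE /= FIK.
Qed.

(** The companion automorphism of [f] maps [iota F] into itself by [rmorph_finField_range], so
    scalars of [F] are sent to scalars of [F]. *)
Lemma conjFF_GammaL f : f \in GammaL K r -> conjFF f \in GammaL F (r * t).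
Proof.
move=> /GammaLP[fD [s _ fZ]]; apply/GammaLP/semilinearI => //.
- exact: perm_inj.
- move=> u v; rewrite -[u]FIK -[v]FIK; set u' := FI u; set v' := FI v.
  by rewrite -FFD !conjFFE fD FFD.
move=> a; have [b sab] := rmorph_finField_range iota s a.
by exists b => v; rewrite -[v]FIK -FFZ !conjFFE fZ sab FFZ.
Qed.

(** Encodes point sets of PG(rt-1, q) by vectors of K^r, where [point_perm (conjFF f)] acts as [f]
    itself and a spread element becomes a K-line without 0. *)
Definition preim_cone A : {set 'rV[K]_r} := FF @^-1: cone A.

Lemma mem_preim_cone A v : (v \in preim_cone A) = (FF v \in cone A).
Proof. by rewrite !inE. Qed.

Lemma preim_cone_inj : injective preim_cone.
Proof.
move=> A B AB; apply: cone_inj; apply/setP => w.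
by have /setP/(_ (FI w)) := AB; rewrite !mem_preim_cone FIK.
Qed.

Lemma preim_cone_point_perm f A : conjFF f \in GammaL F (r * t) ->
  preim_cone (point_perm (conjFF f) @: A) = f @: preim_cone A.
Proof.
move=> fG; apply/setP => v; rewrite mem_preim_cone cone_point_perm //.
rewrite -[v](permKV f) -conjFFE !(mem_imset _ _ perm_inj).
by rewrite mem_preim_cone.
Qed.

Lemma preim_cone_psub U v :
  (v \in preim_cone (psub U)) = (v != 0) && (FF v \in U).
Proof. by rewrite mem_preim_cone cone_psub -{1}FF0 (inj_eq FF_inj). Qed.

Lemma preim_cone_spread_elt u v :
  (u \in preim_cone (spread_elt FF v)) = (u != 0) && (u \in <[v]>%VS).
Proof.
have [-> | u_neq0] /= := eqVneq u 0; first by rewrite !inE FF0 eqxx.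
have FFu_neq0 : FF u != 0 by rewrite -FF0 (inj_eq FF_inj).
rewrite mem_preim_cone (@mem_cone_line _ _ (line_point FFu_neq0)) // inE /=.
apply/existsP/vlineP => [[a /andP[a_neq0 /eqP uav]] | [a uav]].
  (* Equal F-lines differ by a scalar [b] of [F], which is absorbed into the scalar [a] of [K]. *)
  have /vlineP[b] : FF u \in <[FF (a *: v)]>%VS by rewrite -uav memv_line.
  by rewrite -FFZ scalerA => /FF_inj->; exists (iota b * a).
exists a; rewrite uav eqxx andbT.
by apply: contra u_neq0 => /eqP a0; rewrite uav a0 scale0r.
Qed.

Lemma spread_elt_line v w : <[v]>%VS = <[w]>%VS ->
  spread_elt FF v = spread_elt FF w.
Proof.
move=> vw; apply: preim_cone_inj; apply/setP => u.
apply: etrans (preim_cone_spread_elt u v) _; rewrite vw.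
exact: esym (preim_cone_spread_elt u w).
Qed.

Lemma point_perm_conjFF_spread_elt f v : f \in GammaL K r ->
  point_perm (conjFF f) @: spread_elt FF v = spread_elt FF (f v).
Proof.
move=> fG; apply: preim_cone_inj.
rewrite preim_cone_point_perm ?conjFF_GammaL //.
apply/setP => w; rewrite -[w](permKV f) (mem_imset _ _ perm_inj).
rewrite !preim_cone_spread_elt mem_line_semilinear //.
by rewrite -{2}(semilinear0 fG) (inj_eq perm_inj).
Qed.

Lemma point_perm_conjFF_spread f : f \in GammaL K r ->
  [set point_perm (conjFF f) @: (S : {set _}) | S in spread FF] = spread FF.
Proof.
move=> fG; have f_neq0 v : (f v != 0) = (v != 0).
  by rewrite -{1}(semilinear0 fG) (inj_eq perm_inj).
apply/setP => S; apply/imsetP/imsetP.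
  move=> [_ /imsetP[v v_neq0 ->] ->].
  by exists (f v); rewrite ?point_perm_conjFF_spread_elt // inE f_neq0.
move=> [v v_neq0 ->]; exists (spread_elt FF (f^-1 v)%g); last first.
  by rewrite point_perm_conjFF_spread_elt ?permKV.
by apply: imset_f; rewrite inE -f_neq0 permKV.
Qed.

(* For each [a], [proportional_additive] applied to [f] and [v |-> f (a v)]
   yields the image of [a] under the companion automorphism of [f]. *)
Lemma GammaL_of_spread f : conjFF f \in GammaL F (r * t) ->
  [set point_perm (conjFF f) @: (S : {set _}) | S in spread FF] = spread FF ->
  f \in GammaL K r.
Proof.
move=> cfG spreadE; have fD : {morph f : u v / u + v}.
  move=> u v; apply: FF_inj; have /GammaLP[cfD _] := cfG.
  by rewrite -conjFFE FFD cfD !conjFFE FFD.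
have f0 := additive0 fD.
(* The image of the spread element of [u] is that of some [w], so [f] maps the K-line of [u] onto
   that of [w]; as the latter contains [f u], it is the K-line of [f u]. *)
have f_line u v : u != 0 -> (f v \in <[f u]>%VS) = (v \in <[u]>%VS).
  move=> u_neq0; have [-> | v_neq0] := eqVneq v 0; first by rewrite f0 !mem0v.
  have : point_perm (conjFF f) @: spread_elt FF u \in spread FF.
    by rewrite -spreadE !imset_f.
  case/imsetP=> w _ /(congr1 preim_cone).
  rewrite preim_cone_point_perm // => /setP uw.
  have {}uw x : x != 0 -> (x \in <[u]>%VS) = (f x \in <[w]>%VS).
    move=> x_neq0; have := uw (f x); rewrite (mem_imset _ _ perm_inj).
    by rewrite !preim_cone_spread_elt -{2}f0 (inj_eq perm_inj) x_neq0.
  rewrite uw // (@vline_eq _ _ w (f u)) //; last by rewrite -uw ?memv_line.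
  by rewrite -f0 (inj_eq perm_inj).
apply/GammaLP/semilinearI => // [|a]; first exact: perm_inj.
apply: (@proportional_additive _ _ _ f (fun v => f (a *: v))) => //.
- by move=> u v /=; rewrite scalerDr fD.
- exact: perm_inj.
- by move=> u v u_neq0; rewrite f_line.
move=> v; have [-> | v_neq0] := eqVneq v 0; first by rewrite scaler0 f0 mem0v.
by rewrite f_line // memvZ ?memv_line.
Qed.

Lemma mem_linsetP P U :
  reflect (exists2 v, v \in preim_cone (psub U) & val P = <[v]>%VS)
    (P \in linset FF U).
Proof.
rewrite inE; apply: (iffP existsP) => -[v].
  case/and3P=> vU v_neq0 /eqP Pv.
  by exists v => //; rewrite mem_preim_cone cone_psub v_neq0.
rewrite mem_preim_cone cone_psub => /andP[v_neq0 vU] Pv.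
by exists v; rewrite vU v_neq0 Pv /=.
Qed.

(** A linear set consists of the K-lines through the vectors of its subspace, so it moves along with
    them. The case [W = U] shows that stabilising pi implies stabilising L. *)
Lemma linset_point_perm f U W : f \in GammaL K r ->
  preim_cone (psub W) = f @: preim_cone (psub U) ->
  linset FF W = point_perm f @: linset FF U.
Proof.
move=> fG WU; have lineE v : v \in preim_cone (psub U) ->
    forall P, val P = <[v]>%VS -> val (point_perm f P) = <[f v]>%VS.
  by rewrite preim_cone_psub => /andP[v_neq0 _] P; apply: point_perm_line.
apply/setP => P; rewrite -[P](permKV (point_perm f)) (mem_imset _ _ perm_inj).
set Q := ((point_perm f)^-1)%g P; apply/mem_linsetP/mem_linsetP.
  case=> _ /[!WU]/imsetP[v vU ->] Qfv; exists v => //; apply/vspaceP => u.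
  by rewrite -(mem_point_perm fG) Qfv mem_line_semilinear.
by case=> v vU Qv; exists (f v); [rewrite WU imset_f | apply: lineE].
Qed.

(** * Stabilisers, orbits and condition (A) for a fixed linear set *)

Section LinearSet.
Variable U : {vspace 'rV[F]_(r * t)}.
Let L := linset FF U.
Let X := subspaces_with_linset FF L (\dim U).
Let S0 := preim_cone (psub U).
Let G := Group (GammaL_group_set K r_gt0).
(** The stabiliser of L in GammaL(r, q^t); its orbit of [S0], the encoding of pi, is what condition
    (A) is about. *)
Let GL := ('N_G(cone L | 'P))%G.

Lemma card_PGammaL_linset :
  (#|'N_(PGammaL K r)(L | 'P)%g| * #|K|.-1)%N = #|GL|.
Proof.
rewrite card_GammaL_lift //; apply: eq_card => f; rewrite in_set [RHS]in_setI.
by have [fG | //] := boolP (f \in GammaL K r); apply: point_perm_astabs.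
Qed.

(** Lifted to vectors, the left side counts F-semilinear maps that preserve the spread and pi. They
    are K-semilinear by [GammaL_of_spread] and stabilise L since they stabilise pi, so they
    correspond to the stabiliser of [S0] in [GL]. *)
Lemma card_PGammaL_spread :
  (#|'N_('N_(PGammaL F (r * t))(spread FF | 'P^* ))(psub U | 'P)%g| * #|F|.-1)%N
    = #|'N_GL(S0 | 'P)%g|.
Proof.
rewrite -setIA card_GammaL_lift // -(card_imset _ conjFF_inj).
apply: eq_card => g; have [f ->] := conjFF_surj g.
rewrite (mem_imset _ _ conjFF_inj) in_set.
apply/andP/setIP => [[cfG /setIP[]] | [/setIP[fG fL] fS]].
  rewrite mem_astabs_set_perm mem_astabs_perm => /eqP f_spread /eqP fU.
  have fG := GammaL_of_spread cfG f_spread.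
  have fS : S0 = f @: S0 by rewrite -preim_cone_point_perm // fU.
  split; last by rewrite mem_astabs_perm -fS.
  rewrite in_setI [_ \in _]fG -point_perm_astabs //.
  by rewrite mem_astabs_perm -(linset_point_perm fG fS) eqxx.
have cfG := conjFF_GammaL fG; split=> //; rewrite in_setI.
rewrite mem_astabs_set_perm point_perm_conjFF_spread // eqxx mem_astabs_perm.
by rewrite -(inj_eq preim_cone_inj) preim_cone_point_perm // -mem_astabs_perm.
Qed.

(** An element of [GL] is F-semilinear, so it maps pi to a subspace of the same dimension, whose
    linear set is the image of L, that is, L. *)
Lemma orbit_subset : orbit 'P^* GL S0 \subset preim_cone @: X.
Proof.
apply/subsetP => _ /orbitP[f /setIP[fG fL] <-].
have cfG := conjFF_GammaL fG.
have [W WU cfW] := semilinear_image U rt_gt0 cfG.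
have fS0 : preim_cone (psub W) = f @: S0.
  rewrite -preim_cone_point_perm //; congr preim_cone; apply: cone_inj.
  rewrite cone_point_perm //; apply/setP => w; rewrite -[w](permKV (conjFF f)).
  rewrite (mem_imset _ _ perm_inj) !cone_psub cfW.
  by rewrite -{1}(semilinear0 cfG) (inj_eq perm_inj).
apply/imsetP; exists (psub W); last by rewrite fS0.
apply: imset_f; rewrite inE WU eqxx (linset_point_perm fG fS0) /=.
by rewrite -mem_astabs_perm point_perm_astabs.
Qed.

Lemma condition_A_orbit :
  condition_A FF L (\dim U) <-> preim_cone @: X \subset orbit 'P^* GL S0.
Proof.
split=> [condA | subX].
  apply/subsetP => _ /imsetP[_ /imsetP[W] WX -> ->].
  move: WX; rewrite inE => /andP[/eqP dimW /eqP LW].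
  (* Condition (A) for the pair [U], [W] gives a map preserving the spread; it comes from a
     K-semilinear [f], which fixes L because both subspaces have linear set L. *)
  have [g gG [gUW g_spread _]] := condA U W erefl dimW erefl LW.
  move: gG gUW g_spread; rewrite PGammaLE => /imsetP[g' g'G ->].
  have [f g'f] := conjFF_surj g'; rewrite {g'}g'f in g'G *.
  move=> fUW f_spread; have fG := GammaL_of_spread g'G f_spread.
  have fS0 : preim_cone (psub W) = f @: S0.
    by rewrite -preim_cone_point_perm // fUW.
  apply/orbitP; exists f => //; rewrite inE [_ \in _]fG -point_perm_astabs //.
  by rewrite mem_astabs_perm -(linset_point_perm fG fS0) LW eqxx.
move=> V W dimV dimW LV LW.
have inX Y : \dim Y = \dim U -> linset FF Y = L ->
    preim_cone (psub Y) \in orbit 'P^* GL S0.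
  move=> dY LY; apply: (subsetP subX); apply: imset_f; apply: imset_f.
  by rewrite inE dY LY !eqxx.
(* [V] and [W] both lie in the orbit of [U], so the orbit may be based at [V], which yields an [f]
   taking [V] to [W]. *)
have := inX W dimW LW; rewrite -(orbit_eqP (inX V dimV LV)).
case/orbitP=> f /setIP[fG fL] fVW; have cfG := conjFF_GammaL fG.
exists (point_perm (conjFF f)); first by rewrite PGammaLE imset_f.
split; first by apply: preim_cone_inj; rewrite preim_cone_point_perm.
  exact: point_perm_conjFF_spread.
exists (point_perm f); first by rewrite PGammaLE imset_f.
move=> P v w Pv Pw.
have v_neq0 : v != 0 by have := valP P; rewrite Pv dim_vline eqb1.
rewrite (point_perm_conjFF_spread_elt v fG); apply: spread_elt_line.
by rewrite -(point_perm_line fG v_neq0 Pv).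
Qed.

(** By orbit-stabiliser, [#|GL|] is the orbit size times the stabiliser size. Since the orbit is
    contained in the encoded [X], equal cardinalities mean that it is everything. *)
Lemma condition_A_card :
  condition_A FF L (\dim U) <-> (#|X| * #|'N_GL(S0 | 'P)%g|)%N = #|GL|.
Proof.
rewrite condition_A_orbit -(card_imset X preim_cone_inj).
have -> : #|GL| = (#|orbit 'P^* GL S0| * #|'N_GL(S0 | 'P)%g|)%N.
  by rewrite card_orbit astab1_set mulnC Lagrange // subsetIl.
split=> [subX | /eqP]; first congr (_ * _)%N.
  by apply/eqP; rewrite eqn_leq !subset_leq_card ?orbit_subset.
rewrite eqn_pmul2r ?cardG_gt0 // => /eqP eq_card.
have /eqP <- : orbit 'P^* GL S0 == preim_cone @: X; last by [].
by rewrite eqEcard orbit_subset eq_card /=.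
Qed.

End LinearSet.
End Reduction.

Theorem theorem6p10 (q t r n : nat) (F K : finFieldType)
    (iota : {rmorphism F -> K}) (FF : 'rV[K]_r -> 'rV[F]_(r * t))
    (U : {vspace 'rV[F]_(r * t)}) :
  #|F| = q -> #|K| = (q ^ t)%N -> (1 < r)%N ->
  vfr_map iota FF -> \dim U = n ->
  condition_A FF (linset FF U) n <->
  #|subspaces_with_linset FF (linset FF U) n|%:R =
    #|'N_(PGammaL K r)(linset FF U | 'P)%g|%:R /
    #|'N_('N_(PGammaL F (r * t))(spread FF | 'P^* ))(psub U | 'P)%g|%:R *
    ((q%:R ^+ t - 1) / (q%:R - 1)) :> rat.
Proof.
move=> cardF cardK r_gt1 [[FI FFK FIK] FFD FFZ] <-.
have t_gt0 : (0 < t)%N.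
  have := finNzRing_gt1 K; rewrite cardK.
  (* For [t = 0] the field [K] would have a single element. *)
  by case: (t).
rewrite (condition_A_card FFK FIK FFD FFZ r_gt1 t_gt0).
have := card_PGammaL_linset FF r_gt1 U.
have := card_PGammaL_spread FFK FIK FFD FFZ r_gt1 t_gt0 U.
have pred_natr m : (0 < m)%N -> m.-1%:R = m%:R - 1 :> rat.
  by case: m => // m _; rewrite -[in RHS]natr1 addrK.
have q_gt0 : (0 < q)%N by rewrite -cardF ltnW ?finNzRing_gt1.
(* Merging the fractions pairs each group order with the number of scalars, so the right side
   becomes [#|GL|] over the order of the stabiliser of [S0]. *)
rewrite mulf_div -natrX -!pred_natr ?expn_gt0 ?q_gt0 // -!natrM -cardK -cardF.
move=> -> ->; set N := #|_|%N; set s := #|'N_(_)(_ | _)%g|.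
have s_neq0 : s%:R != 0 :> rat by rewrite Num.Theory.pnatr_eq0 -lt0n cardG_gt0.
split=> [<- | /eqP]; first by rewrite natrM mulfK.
by rewrite -(inj_eq (mulIf s_neq0)) divfK // -natrM Num.Theory.eqr_nat => /eqP.
Qed.
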